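(* Let $(G,\circ)$ be a finite group, let $N$ be a $G$-stable regular subgroup of $\mathrm{Perm}(G)$, let $(G,\star,\circ)$ be the corresponding skew brace, and let $g\in G$. The following are equivalent: (i) $N$ is normalized by $\rho(g)$; (ii) the inner automorphism $\varphi_g$ of $(G,\circ)$ lies in $\mathrm{Aut}(G,\star,\circ)$; (iii) $(y\star z)\circ g=(y\circ g)\star g^{-1}\star(z\circ g)$ for all $y,z\in G$, where $g^{-1}$ denotes the inverse of $g$ with respect to $\star$.
   Context: $\mathrm{Perm}(G)$ is the group of permutations of the set $G$; $\lambda(g)[h]=g\circ h$ and $\rho(g)[h]=h\circ \bar g$, where $\bar g$ is the inverse of $g$ in $(G,\circ)$. A subgroup $N\le\mathrm{Perm}(G)$ is regular if it acts simply transitively on $G$ and $G$-stable if normalized by $\lambda(G)$. A (left) skew brace is a triple $(B,\star,\circ)$ of a set with two group operations such that $x\circ(y\star z)=(x\circ y)\star x^{-1}\star(x\circ z)$ for all $x,y,z$ ($x^{-1}$ the $\star$-inverse). The skew brace corresponding to $N$: since $\eta\mapsto\eta[e_G]$ is a bijection $N\to G$, define $\eta[e_G]\star\mu[e_G]=\eta\mu[e_G]$ for $\eta,\mu\in N$; then $(G,\star,\circ)$ is a skew brace. $\varphi_g(h)=g\circ h\circ\bar g$. $\mathrm{Aut}(G,\star,\circ)$ is the group of automorphisms of $(G,\circ)$ that are also automorphisms of $(G,\star)$. *)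

(* Defs.v *)
From mathcomp Require Import all_boot all_fingroup.

Set Implicit Arguments.
Unset Strict Implicit.
Unset Printing Implicit Defensive.

Local Open Scope group_scope.

Record group_law (T : Type) := GroupLaw {
  gop :> T -> T -> T;
  gone : T;
  ginv : T -> T;
  gopA : associative gop;
  gop1l : left_id gone gop;
  gopVl : left_inverse gone ginv gop
}.

(** A skew brace [(gT, star, o)] whose multiplicative group [(gT, o)] is the
    given finite group [gT]. *)
Record skew_brace (gT : finGroupType) := SkewBrace {
  star : group_law gT;
  star_compat : forall x y z : gT,
    x * star y z = star (star (x * y) (ginv star x)) (x * z)
}.

Definition star_inv (gT : finGroupType) (B : skew_brace gT) : gT -> gT :=
  ginv (star B).

Definition Aut_brace (gT : finGroupType) (B : skew_brace gT) : {set {perm gT}} :=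
  [set a in Aut [set: gT] |
    [forall x, forall y, a (star B x y) == star B (a x) (a y)]].

Section Translations.
Variable gT : finGroupType.
Implicit Types g h : gT.

Definition lambda g : {perm gT} := perm (mulgI g).
Definition rho g : {perm gT} := perm (mulIg g^-1).

Fact inner_subproof g : injective (fun h : gT => g * h * g^-1).
Proof. by move=> x y /mulIg/mulgI. Qed.
Definition inner g : {perm gT} := perm (@inner_subproof g).

Lemma lambdaE g h : lambda g h = g * h.
Proof. by rewrite permE. Qed.

Lemma rhoE g h : rho g h = h * g^-1.
Proof. by rewrite permE. Qed.

Lemma innerE g h : inner g h = g * h * g^-1.
Proof. by rewrite permE. Qed.

End Translations.

Lemma Aut_brace_group_set (gT : finGroupType) (B : skew_brace gT) :
  group_set (Aut_brace B).
Proof.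
apply/group_setP; split=> [|a b].
  apply/setIdP; split; first exact: group1.
  by apply/forallP=> x; apply/forallP=> y; rewrite !perm1.
move=> /setIdP[Aa /forallP Sa] /setIdP[Ab /forallP Sb].
apply/setIdP; split; first exact: groupM.
apply/forallP=> x; apply/forallP=> y.
by rewrite !permM (eqP (forallP (Sa x) y)) (eqP (forallP (Sb _) _)).
Qed.
Canonical Aut_brace_group (gT : finGroupType) (B : skew_brace gT) :=
  Group (Aut_brace_group_set B).

Definition regular (gT : finGroupType) (N : {group {perm gT}}) : Prop :=
  forall x y : gT, exists! eta : {perm gT}, eta \in N /\ eta x = y.

Definition G_stable (gT : finGroupType) (N : {group {perm gT}}) : Prop :=
  [set lambda g | g in [set: gT]] \subset 'N(N).

Section CorrespondingBrace.
Variables (gT : finGroupType) (N : {group {perm gT}}).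
Implicit Types x y z : gT.

(** The inverse of the bijection [eta |-> eta 1] from [N] to [gT]; the default
    value is never reached when [N] is regular. *)
Definition reg_elt x : {perm gT} :=
  odflt 1 [pick eta in N | eta (1 : gT) == x].

(** [x = eta 1] and [y = mu 1] give [star x y = (eta o mu) 1]; the product of
    [{perm gT}] is composition in the reverse order, so [eta o mu] is
    [mu * eta]. *)
Definition reg_op x y : gT := (reg_elt y * reg_elt x) (1 : gT).
Definition reg_inv x : gT := (reg_elt x)^-1 (1 : gT).

Hypothesis regN : regular N.

Lemma regular_inj x : {in N &, forall eta mu : {perm gT}, eta x = mu x -> eta = mu}.
Proof.
move=> eta mu Ne Nm e.
have [nu [_ U]] := regN x (mu x).
by rewrite -(U eta) ?(U mu).
Qed.

Lemma reg_eltP x : reg_elt x \in N /\ reg_elt x (1 : gT) = x.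
Proof.
rewrite /reg_elt; case: pickP => [eta /andP[Ne /eqP] // | no].
by have [eta [[Ne e] _]] := regN 1 x; have := no eta; rewrite Ne e eqxx.
Qed.

Lemma reg_eltK eta : eta \in N -> reg_elt (eta (1 : gT)) = eta.
Proof.
by move=> Ne; have [? ?] := reg_eltP (eta (1 : gT)); apply: (@regular_inj 1).
Qed.

Lemma reg_op_perm x y : reg_op x y = reg_elt x y.
Proof. by rewrite /reg_op permM (reg_eltP y).2. Qed.

Lemma reg_opE eta mu : eta \in N -> mu \in N ->
  reg_op (eta (1 : gT)) (mu (1 : gT)) = eta (mu (1 : gT)).
Proof. by move=> Ne Nm; rewrite reg_op_perm reg_eltK. Qed.

Lemma reg_elt_op x y : reg_elt (reg_op x y) = reg_elt y * reg_elt x.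
Proof.
have [Nx _] := reg_eltP x; have [Ny _] := reg_eltP y.
by rewrite /reg_op reg_eltK ?groupM.
Qed.

Lemma reg_elt_inv x : reg_elt (reg_inv x) = (reg_elt x)^-1.
Proof. by rewrite /reg_inv reg_eltK ?groupV //; have [] := reg_eltP x. Qed.

Lemma reg_opA : associative reg_op.
Proof.
by move=> x y z; rewrite [RHS]reg_op_perm reg_elt_op permM -!reg_op_perm.
Qed.

Lemma reg_op1l : left_id 1 reg_op.
Proof. by move=> x; rewrite reg_op_perm -{1}(perm1 (1 : gT)) reg_eltK ?perm1. Qed.

Lemma reg_opVl : left_inverse 1 reg_inv reg_op.
Proof.
by move=> x; rewrite reg_op_perm reg_elt_inv -{2}(reg_eltP x).2 permK.
Qed.

Hypothesis stabN : G_stable N.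

Lemma reg_op_compat x y z :
  x * reg_op y z = reg_op (reg_op (x * y) (reg_inv x)) (x * z).
Proof.
have [Nx x1] := reg_eltP x; have [Ny y1] := reg_eltP y.
have [Nxy xy1] := reg_eltP (x * y).
have Ll : lambda x \in 'N(N) by apply: (subsetP stabN); apply: imset_f.
have conjE t : (reg_elt y ^ lambda x) (x * t) = x * reg_elt y t.
  by rewrite -{1}lambdaE permJ lambdaE.
have -> : x * reg_op y z = (reg_elt y ^ lambda x) (x * z).
  by rewrite conjE reg_op_perm.
rewrite reg_op_perm reg_elt_op reg_elt_inv; congr (fun_of_perm _ _).
apply: (@regular_inj x); rewrite ?memJ_norm ?groupM ?groupV //.
have xV : (reg_elt x)^-1 x = 1 by rewrite -{2}x1 permK.
by rewrite -{2}[x]mulg1 conjE y1 permM xV xy1.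
Qed.

Definition brace_of : skew_brace gT :=
  @SkewBrace gT (GroupLaw reg_opA reg_op1l reg_opVl) reg_op_compat.

End CorrespondingBrace.

(* Main.v *)
Require Import Defs.
From mathcomp Require Import all_boot all_fingroup.

Set Implicit Arguments.
Unset Strict Implicit.
Unset Printing Implicit Defensive.

Local Open Scope group_scope.

(** Since [inner g] is [lambda g] composed with [rho g] and [N] is [G]-stable,
    [rho g] normalizes [N] iff [inner g] does; as [inner g] fixes the identity,
    conjugation by it then sends the element of [N] over [x] to the one over
    [inner g x]. Right multiplication by [g] is [lambda g] after [inner g^-1],
    so if [inner g^-1] respects [star], (iii) is the brace relation at [x = g]
    applied to [inner g^-1 y] and [inner g^-1 z]. Finally, (iii) says that the
    conjugate by [rho g^-1] of the element of [N] over [y] is again the left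
    [star]-translation by some element, that is, a member of [N]. *)

Section InnerRho.
Variable gT : finGroupType.
Implicit Types g x : gT.

Lemma inner_lambda_rho g : inner g = lambda g * rho g.
Proof. by apply/permP=> h; rewrite permM innerE lambdaE rhoE. Qed.

Lemma rhoV g : rho g^-1 = (rho g)^-1.
Proof.
by apply/eqP; rewrite eq_sym eq_invg_mul; apply/eqP/permP=> h;
   rewrite permM !rhoE invgK mulgKV perm1.
Qed.

Lemma innerV g : inner g^-1 = (inner g)^-1.
Proof.
apply/eqP; rewrite eq_sym eq_invg_mul; apply/eqP/permP=> h.
by rewrite permM !innerE invgK perm1 !mulgA mulVg mul1g mulgKV.
Qed.

Lemma inner_Aut g : inner g \in Aut [set: gT].
Proof.
rewrite inE; apply/andP; split; first by apply/subsetP=> x _; rewrite inE.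
by apply/morphicP=> x y _ _; rewrite !innerE !mulgA mulgKV.
Qed.

End InnerRho.

(** Both sides lie in [N] and send [1] to [a x], so regularity identifies them. *)
Lemma reg_elt_conj (gT : finGroupType) (N : {group {perm gT}})
    (regN : regular N) (a : {perm gT}) (x : gT) :
  a \in 'N(N) -> a (1 : gT) = 1 -> reg_elt N x ^ a = reg_elt N (a x).
Proof.
move=> Na a1; have [Nx x1] := reg_eltP regN x.
have [Nax ax1] := reg_eltP regN (a x).
apply: (regular_inj regN (x := 1)); rewrite ?memJ_norm //.
by rewrite ax1 -{1}a1 permJ x1.
Qed.

Theorem theorem4p2 (gT : finGroupType) (N : {group {perm gT}})
    (regN : regular N) (stabN : G_stable N) (g : gT) :
  let B := brace_of regN stabN in
  [<-> rho g \in 'N(N);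
       inner g \in Aut_brace B;
       forall y z : gT,
         star B y z * g = star B (star B (y * g) (star_inv B g)) (z * g)].
Proof.
move=> B; tfae.
- move=> Nrho.
  have Ninner : inner g \in 'N(N).
    rewrite inner_lambda_rho groupM //.
    by apply: (subsetP stabN); apply: imset_f.
  rewrite inE inner_Aut; apply/forallP=> x; apply/forallP=> y; apply/eqP.
  rewrite /= !(reg_op_perm regN) -(reg_elt_conj regN) ?permJ //.
  by rewrite innerE mulg1 mulgV.
- move=> Ag y z.
  have: inner g^-1 \in Aut_brace B by rewrite innerV groupV.
  case/setIdP=> _ /forallP/(_ y)/forallP/(_ z)/eqP/(congr1 (fun h => g * h)).
  by rewrite star_compat !innerE invgK !mulgA !mulgV !mul1g.
(* [rho g^-1] is right multiplication by [g]; as [N] is finite, containment of its conjugate in [N]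
   suffices. *)
- move=> right_compat; rewrite -groupV -rhoV inE.
  apply/subsetP=> _ /imsetP[eta Neta ->].
  (* The only candidate: by (iii) at [z = g^-1] (inverse in [gT]), [w] is the image of [1] under the
     conjugate. *)
  set w := star B (eta (1 : gT) * g) (star_inv B g).
  suff -> : eta ^ rho g^-1 = reg_elt N w by case: (reg_eltP regN w).
  apply/permP=> t; rewrite -[t](mulgKV g); move: (t * g^-1) => z.
  have rhoVE h : rho g^-1 h = h * g by rewrite rhoE invgK.
  (* The conjugate sends [z * g] to [eta z * g]. *)
  rewrite -{1}rhoVE permJ rhoVE -(reg_op_perm regN).
  by rewrite -[RHS]right_compat /= (reg_op_perm regN) (reg_eltK regN).
Qed.
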